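(* Consider an instance of the one-dimensional floor layout problem (1D-FLP) with $N$ components, half-widths $\ell_i$, weights $p_{i,j}\ge 0$ and floor length $L \geq 2\sum_{i=1}^N \ell_i$, and the formulation of 1D-FLP given in the context, augmented with the inequalities $$d_{i,j} \geq \ell_i + \ell_j \quad \forall\, 1\le i<j\le N .$$ Then the lifted LP representation and the lifted SDP representation of this augmented formulation both have optimal cost equal to $\omega_2$.
   Context: Notation: $P(C)$ is the set of (unordered) pairs $(i,j)$ of distinct elements of $C$, represented with $i<j$; $[N]=\{1,\dots,N\}$. **1D-FLP formulation.** Data: $N\in\mathbb{N}$, half-widths $\ell_i>0$ ($i\in[N]$), weights $p_{i,j}\ge 0$ for $(i,j)\in P([N])$, floor length $L$. Variables: $c_i$ ($i\in[N]$), $d_{i,j}$ ($(i,j)\in P([N])$), $z_{i,j}$ ($i,j\in[N]$, $i\ne j$, ordered pairs). Minimize $\sum_{(i,j)\in P([N])}p_{i,j}d_{i,j}$ subject to: (1) $d_{i,j}\ge c_i-c_j$ and $d_{i,j}\ge c_j-c_i$ for $(i,j)\in P([N])$; (2) $c_i+\ell_i\le c_j-\ell_j+L(1-z_{i,j})$ for all $i\neq j$; (3) $z_{i,j}+z_{j,i}=1$ for $(i,j)\in P([N])$; (4) $0\le c_i\le L$ for all $i$; (5) $d_{i,j}\ge 0$ for $(i,j)\in P([N])$; (6) $0\le z_{i,j}\le 1$ for all $i\ne j$; (7) $z_{i,j}\in\{0,1\}$ for all $i\neq j$. Standing assumption: the floor is large enough that every layout is feasible, $L\ge 2\sum_i \ell_i$.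 **Lifted LP representation.** Let $\lambda=(c,d,z)$ and let $A\lambda\le b$ be the linear system (an equation being two inequalities) consisting of (1)–(6) (integrality dropped) and the added inequalities $d_{i,j}\ge \ell_i+\ell_j$. For each ordered pair $(r,s)$, $r\ne s$, multiply every inequality by $z_{r,s}$ and by $1-z_{r,s}$, obtaining $$z_{r,s}(b-A\lambda)\ge 0,\qquad (1-z_{r,s})(b-A\lambda)\ge 0 .$$ Linearize: replace each product $u\,z_{r,s}$ of a variable $u$ among the $c$'s, $d$'s, $z$'s with $z_{r,s}$ by a new variable $y(u,z_{r,s})$, where $y(z_{i,j},z_{r,s})=y(z_{r,s},z_{i,j})$ and $y(z_{r,s},z_{r,s})=z_{r,s}$. The lifted LP representation is the linear program minimizing $\sum_{(i,j)\in P([N])}p_{i,j}d_{i,j}$ over all $(c,d,z,y)$ satisfying the resulting linear system. **Lifted SDP representation.** The same problem with the additional constraint $M\succeq 0$, where $M$ is the symmetric matrix with rows and columns indexed by $\{\emptyset\}\cup\{(r,s)\in[N]^2: r\neq s\}$ and entries $M_{\emptyset,\emptyset}=1$, $M_{(i,j),\emptyset}=M_{\emptyset,(i,j)}=z_{i,j}$, $M_{(i,j),(r,s)}=y(z_{i,j},z_{r,s})$. **Combinatorial bound.** For $C\subseteq[N]$ let $\gamma(C)$ be the minimum of $\sum_{(i,j)\in P(C)}p_{i,j}d_{i,j}$ over all $(c,d,z)$ satisfying (1)–(7). For $k\in\mathbb{N}$, $$\omega_k:=\min\Big\{\sum_{(i,j)\in P([N])}p_{i,j}d_{i,j} : d\ge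 0,\ \sum_{(i,j)\in P(C)}p_{i,j}d_{i,j}\ge\gamma(C)\ \ \forall C\subseteq[N],\ |C|\le k\Big\}.$$ (For 1D-FLP, $\omega_2=\sum_{(i,j)\in P([N])}p_{i,j}(\ell_i+\ell_j)$.) *)

(* Defs.v *)
From HB Require Import structures.
From mathcomp Require Import all_boot all_order all_algebra.
From mathcomp Require Import boolp classical_sets reals.

Set Implicit Arguments.
Unset Strict Implicit.
Unset Printing Implicit Defensive.

Import Order.TTheory GRing.Theory Num.Theory.
Local Open Scope classical_set_scope.
Local Open Scope ring_scope.

(* Components are 0, ..., N.-1.  An unordered pair of distinct components is
   represented by its increasing listing. *)
Notation upair N := {e : 'I_N * 'I_N | (e.1 < e.2)%N}.
Notation opair N := {w : 'I_N * 'I_N | w.1 != w.2}.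

Lemma upair_neq N (e : upair N) : (val e).1 != (val e).2.
Proof. by case: e => -[i j] /= lt_ij; rewrite neq_ltn lt_ij. Qed.

Lemma upair_neqC N (e : upair N) : (val e).2 != (val e).1.
Proof. by rewrite eq_sym upair_neq. Qed.

Definition forward N (e : upair N) : opair N := exist _ (val e) (upair_neq e).

Definition backward N (e : upair N) : opair N :=
  exist _ ((val e).2, (val e).1) (upair_neqC e).

(* The variables of the formulation: c_i, d_{i,j} for i < j, and z_{i,j} for
   i != j. *)
Notation flp_var N := ('I_N + upair N + opair N)%type.

Definition cvar N (i : 'I_N) : flp_var N := inl (inl i).
Definition dvar N (e : upair N) : flp_var N := inl (inr e).
Definition zvar N (w : opair N) : flp_var N := inr w.

(* (a, f) stands for the affine form a + \sum_u f u * u. *)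
Notation affine R N := (R^o * {ffun flp_var N -> R^o})%type.

Definition aconst (R : realType) N (a : R) : affine R N := (a, 0).

Definition avar (R : realType) N (u : flp_var N) : affine R N :=
  (0, [ffun v => (v == u)%:R]).

Definition aeval (R : realType) N (f : affine R N) (x : flp_var N -> R) : R :=
  f.1 + \sum_u f.2 u * x u.

(* The linear systems below are given by their slacks b - A lambda, each of
   which is required to be nonnegative; an equation yields two slacks. *)
Inductive flp_slack (R : realType) N (l : 'I_N -> R) (L : R) :
    affine R N -> Prop :=
| Slack_dist e :
    flp_slack l L
      (avar R (dvar e) - (avar R (cvar (val e).1) - avar R (cvar (val e).2)))
| Slack_distC e :
    flp_slack l L
      (avar R (dvar e) - (avar R (cvar (val e).2) - avar R (cvar (val e).1)))
| Slack_sep w :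
    flp_slack l L
      (avar R (cvar (val w).2) - aconst N (l (val w).2)
         + L *: (aconst N 1 - avar R (zvar w))
       - (avar R (cvar (val w).1) + aconst N (l (val w).1)))
| Slack_order_ge e :
    flp_slack l L
      (avar R (zvar (forward e)) + avar R (zvar (backward e)) - aconst N 1)
| Slack_order_le e :
    flp_slack l L
      (aconst N 1 - (avar R (zvar (forward e)) + avar R (zvar (backward e))))
| Slack_c_ge0 i : flp_slack l L (avar R (cvar i))
| Slack_c_leL i : flp_slack l L (aconst N L - avar R (cvar i))
| Slack_d_ge0 e : flp_slack l L (avar R (dvar e))
| Slack_z_ge0 w : flp_slack l L (avar R (zvar w))
| Slack_z_le1 w : flp_slack l L (aconst N 1 - avar R (zvar w)).

(* The system augmented with d_{i,j} >= l_i + l_j. *)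
Inductive augmented_slack (R : realType) N (l : 'I_N -> R) (L : R) :
    affine R N -> Prop :=
| Slack_flp f : flp_slack l L f -> augmented_slack l L f
| Slack_nonoverlap e :
    augmented_slack l L
      (avar R (dvar e) - aconst N (l (val e).1 + l (val e).2)).

(* The layouts: points of the mixed-integer formulation. *)
Definition layout (R : realType) N (l : 'I_N -> R) (L : R) :
    set (flp_var N -> R) :=
  [set x | (forall f, flp_slack l L f -> 0 <= aeval f x) /\
           (forall w, x (zvar w) = 0 \/ x (zvar w) = 1)].

(* The cost restricted to the pairs in P(C). *)
Definition pair_cost (R : realType) N (p : upair N -> R) (C : {set 'I_N})
    (d : upair N -> R) : R :=
  \sum_(e : upair N | ((val e).1 \in C) && ((val e).2 \in C)) p e * d e.

Definition cost (R : realType) N (p : upair N -> R) (d : upair N -> R) : R :=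
  \sum_(e : upair N) p e * d e.

Definition is_minimum (R : realType) (S : set R) (m : R) : Prop :=
  S m /\ lbound S m.

Definition is_gamma (R : realType) N (l : 'I_N -> R) (p : upair N -> R) (L : R)
    (C : {set 'I_N}) (g : R) : Prop :=
  is_minimum [set pair_cost p C (x \o @dvar N) | x in layout l L] g.

(* Both minima are asserted to be attained, so no default value is involved. *)
Definition is_omega (R : realType) N (l : 'I_N -> R) (p : upair N -> R) (L : R)
    (k : nat) (v : R) : Prop :=
  exists gamma : {set 'I_N} -> R,
    (forall C : {set 'I_N}, (#|C| <= k)%N -> is_gamma l p L C (gamma C)) /\
    is_minimum
      [set cost p d | d in
        [set d : upair N -> R |
          (forall e, 0 <= d e) /\
          (forall C : {set 'I_N}, (#|C| <= k)%N ->
             gamma C <= pair_cost p C d)]] v.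

(* A point (x, y) of the lifted space: x u is the value of the variable u and
   y u w that of the new variable y(u, z_w). *)
Notation lifted_point R N :=
  ((flp_var N -> R) * (flp_var N -> opair N -> R))%type.

(* Linearization of z_w * f. *)
Definition lin_mulz (R : realType) N (f : affine R N) (w : opair N)
    (q : lifted_point R N) : R :=
  f.1 * q.1 (zvar w) + \sum_u f.2 u * q.2 u w.

(* Linearization of (1 - z_w) * f. *)
Definition lin_mulCz (R : realType) N (f : affine R N) (w : opair N)
    (q : lifted_point R N) : R :=
  aeval f q.1 - lin_mulz f w q.

(* The last two conditions are the identifications of the new variables that
   linearize products of z's. *)
Definition lifted_LP (R : realType) N (l : 'I_N -> R) (L : R) :
    set (lifted_point R N) :=
  [set q | [/\ forall f w, augmented_slack l L f ->
                 0 <= lin_mulz f w q /\ 0 <= lin_mulCz f w q,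
               forall w w', q.2 (zvar w) w' = q.2 (zvar w') w
             & forall w, q.2 (zvar w) w = q.1 (zvar w)]].

Definition psd (R : realType) (T : finType) (M : T -> T -> R) : Prop :=
  (forall a b, M a b = M b a) /\
  (forall v : T -> R, 0 <= \sum_a \sum_b v a * M a b * v b).

(* None is the index written \emptyset in the paper. *)
Definition moment_matrix (R : realType) N (q : lifted_point R N)
    (a b : option (opair N)) : R :=
  match a, b with
  | None, None => 1
  | Some w, None | None, Some w => q.1 (zvar w)
  | Some w, Some w' => q.2 (zvar w) w'
  end.

Definition lifted_SDP (R : realType) N (l : 'I_N -> R) (L : R) :
    set (lifted_point R N) :=
  [set q | lifted_LP l L q /\ psd (moment_matrix q)].

Definition is_optimal_cost (R : realType) N (p : upair N -> R)
    (feasible : set (lifted_point R N)) (v : R) : Prop :=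
  is_minimum [set cost p (q.1 \o @dvar N) | q in feasible] v.

(* Main.v *)
Require Import Defs.
From HB Require Import structures.
From mathcomp Require Import all_boot all_order all_algebra.
From mathcomp Require Import boolp classical_sets reals.
From mathcomp Require Import ring lra.

Set Implicit Arguments.
Unset Strict Implicit.
Unset Printing Implicit Defensive.

Import Order.TTheory GRing.Theory Num.Theory.
Local Open Scope classical_set_scope.
Local Open Scope ring_scope.

(* Multiplying [d_e >= l_i + l_j] by [z_w] and [1 - z_w] and adding bounds the
   lifted cost below by that of the touching distances [l_i + l_j], which is
   [omega_2].  That bound is attained by a lifted point with [d_e = l_i + l_j],
   [c_k = L / 2] and [z_w = 1 / 2], which conditionally on [z_{r,s} = 1] moves
   [c_r] to [L / 2 - l_r] and [c_s] to [L / 2 + l_s].  With [S = \sum_k l_k],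
   the separation inequalities then hold as soon as the sign [2 z_{i,j} - 1]
   has conditional mean [(c_j - c_i) / S] for [{i,j} <> {r,s}]; these means
   are the entries of the Gram matrix of the vectors [e_j - e_i] for the weights
   [l_k / S].  This matrix is positive semidefinite with diagonal at most 1,
   and raising its diagonal to 1 keeps it so. *)

(* [aform t f x] is the homogenization of [f]: the constant term is scaled by
   [t], so that [aeval] is the case [t = 1] and [lin_mulz] the case
   [t = z_w], [x = y(-, z_w)]. *)
HB.lock Definition aform (R : realType) N (t : R) (f : affine R N)
    (x : flp_var N -> R) : R :=
  f.1 * t + \sum_u f.2 u * x u.

(* Rewriting with [aform_var] compares distinct variables up to conversion,
   which does not terminate in practice unless [avar] is locked. *)
HB.lock Definition avar_locked (R : realType) N (u : flp_var N) : affine R N :=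
  avar R u.

(** * Homogenized affine forms and the linear system of the formulation *)

Section AffineForms.
Context {R : realType} {N : nat}.
Implicit Types (f g : affine R N) (x : flp_var N -> R) (t a : R).

Lemma aevalE f x : aeval f x = aform 1 f x.
Proof. by rewrite aform.unlock mulr1. Qed.

Lemma lin_mulzE f w (q : lifted_point R N) :
  lin_mulz f w q = aform (q.1 (zvar w)) f (q.2^~ w).
Proof. by rewrite aform.unlock. Qed.

Lemma aformD t f g x : aform t (f + g) x = aform t f x + aform t g x.
Proof.
rewrite aform.unlock /= mulrDl addrACA -big_split /=; congr (_ + _).
by apply: eq_bigr => u _; rewrite ffunE mulrDl.
Qed.

Lemma aformN t f x : aform t (- f) x = - aform t f x.
Proof.
rewrite aform.unlock /= mulNr opprD -sumrN; congr (_ + _).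
by apply: eq_bigr => u _; rewrite ffunE mulNr.
Qed.

Lemma aformZ t a f x : aform t (a *: f) x = a * aform t f x.
Proof.
rewrite aform.unlock /= mulrDr mulrA mulr_sumr; congr (_ + _).
by apply: eq_bigr => u _; rewrite ffunE mulrA.
Qed.

Lemma aform_const t a x : aform t (aconst N a) x = a * t.
Proof.
by rewrite aform.unlock /= big1 ?addr0 // => u _; rewrite ffunE mul0r.
Qed.

Lemma avar_lockedE : @avar_locked = @avar.
Proof. by rewrite avar_locked.unlock. Qed.

Lemma aform_var t u x : aform t (avar_locked R u) x = x u.
Proof.
rewrite avar_lockedE aform.unlock /= mul0r add0r (bigD1 u) //=.
rewrite big1 ?addr0 => [|v /negPf ne].
  by rewrite ffunE eqxx mul1r.
by rewrite ffunE ne mul0r.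
Qed.

Definition aformE := (aformD, aformN, aformZ, aform_const, aform_var).

(** Joint additivity in the scale and the point. It is what lets the products of [f] with [z_w] and
    with the reversed variable add up to [f] itself when the two scales sum to 1. *)
Lemma aform_split t1 t2 f x1 x2 :
  aform (t1 + t2) f (fun u => x1 u + x2 u) = aform t1 f x1 + aform t2 f x2.
Proof.
rewrite aform.unlock mulrDr addrACA -big_split /=; congr (_ + _).
by apply: eq_bigr => u _; rewrite mulrDr.
Qed.

End AffineForms.


(** The scale [t] is kept general so that one characterization serves layouts ([t = 1]) and products
    with [z_w] ([t] the value of [z_w]). The inequalities [d >= 0] are absorbed by the bound on the
    absolute value. *)
Lemma flp_slack_ge0 (R : realType) N (l : 'I_N -> R) (L t : R)
    (x : flp_var N -> R) :
  (forall f, flp_slack l L f -> 0 <= aform t f x) <->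
  [/\ forall e, `|x (cvar (val e).1) - x (cvar (val e).2)| <= x (dvar e),
      forall w, x (cvar (val w).1) + l (val w).1 * t <=
        x (cvar (val w).2) - l (val w).2 * t + L * (t - x (zvar w)),
      forall e, x (zvar (forward e)) + x (zvar (backward e)) = t,
      forall i, 0 <= x (cvar i) <= L * t
    & forall w, 0 <= x (zvar w) <= t].
Proof.
split=> [H|[Hd Hs Ho Hc Hz] f].
  split=> [e|w|e|i|w].
  - have := H _ (Slack_dist l L e); have := H _ (Slack_distC l L e).
    by rewrite -?avar_lockedE !aformE ler_norml; lra.
  - by have := H _ (Slack_sep l L w); rewrite -?avar_lockedE !aformE; lra.
  - have := H _ (Slack_order_ge l L e); have := H _ (Slack_order_le l L e).
    by rewrite -?avar_lockedE !aformE; lra.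
  - have := H _ (Slack_c_ge0 l L i); have := H _ (Slack_c_leL l L i).
    by rewrite -?avar_lockedE !aformE; lra.
  - have := H _ (Slack_z_ge0 l L w); have := H _ (Slack_z_le1 l L w).
    by rewrite -?avar_lockedE !aformE; lra.
case=> [e|e|w|e|e|i|i|e|w|w]; rewrite -?avar_lockedE !aformE.
- by have := Hd e; rewrite ler_norml; lra.
- by have := Hd e; rewrite ler_norml; lra.
- by have := Hs w; lra.
- by have := Ho e; lra.
- by have := Ho e; lra.
- by have := Hc i; lra.
- by have := Hc i; lra.
- exact: le_trans (Hd e).
- by have := Hz w; lra.
- by have := Hz w; lra.
Qed.

Lemma addr_le_sum_distinct (R : realType) (I : finType) (l : I -> R) i j :
  (forall k, 0 <= l k) -> i != j -> l i + l j <= \sum_k l k.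
Proof.
move=> l_ge0 ne; rewrite (bigD1 i) //= (bigD1 j) 1?eq_sym //= addrA lerDl.
exact: sumr_ge0.
Qed.

(** * Positive semidefinite matrices *)

(** The quadratic form is a sum of squares with weights [c i]. *)
Lemma psd_gram (R : realType) (T I : finType) (c : I -> R) (g : I -> T -> R) :
  (forall i, 0 <= c i) -> psd (fun a b => \sum_i c i * (g i a * g i b)).
Proof.
move=> c_ge0; split=> [a b|v].
  by apply: eq_bigr => i _; rewrite [g i a * _]mulrC.
suff -> : \sum_a \sum_b v a * (\sum_i c i * (g i a * g i b)) * v b
          = \sum_i c i * (\sum_a v a * g i a) ^+ 2.
  by apply: sumr_ge0 => i _; rewrite mulr_ge0 ?sqr_ge0.
transitivity (\sum_a \sum_b \sum_i c i * ((v a * g i a) * (v b * g i b))).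
  apply: eq_bigr => a _; apply: eq_bigr => b _.
  by rewrite mulr_sumr mulr_suml; apply: eq_bigr => i _; ring.
under eq_bigr => a _ do rewrite exchange_big /=.
rewrite exchange_big /=; apply: eq_bigr => i _.
rewrite expr2 mulr_suml mulr_sumr; apply: eq_bigr => a _.
by rewrite mulr_sumr mulr_sumr.
Qed.

Lemma psdD (R : realType) (T : finType) (A B : T -> T -> R) :
  psd A -> psd B -> psd (fun a b => A a b + B a b).
Proof.
move=> [symA posA] [symB posB]; split=> [a b|v]; first by rewrite symA symB.
have := addr_ge0 (posA v) (posB v); rewrite -big_split /=.
under eq_bigr => a _.
  rewrite -big_split /=.
  under eq_bigr => b _ do rewrite -mulrDl -mulrDr.
  over.
by [].
Qed.

Lemma psd_ext (R : realType) (T : finType) (A B : T -> T -> R) :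
  (forall a b, A a b = B a b) -> psd A -> psd B.
Proof. by move=> eqAB; have -> : A = B by do 2!apply/funext=> ?. Qed.

(** * Packed layouts and the combinatorial bound *)

Definition touching_dist (R : realType) N (l : 'I_N -> R) (e : upair N) : R :=
  l (val e).1 + l (val e).2.

Section RankedLayout.
Variables (R : realType) (N : nat) (l : 'I_N -> R) (L : R).
Hypothesis l_ge0 : forall i, 0 <= l i.
Hypothesis hL : 2 * (\sum_(i < N) l i) <= L.
Variable rank : 'I_N -> nat.
Hypothesis rank_inj : injective rank.

(** Center of [i] when the components are packed without gaps from 0, in increasing order of
    [rank]. *)
Definition ranked_center i : R :=
  2 * (\sum_(m | (rank m < rank i)%N) l m) + l i.

Definition ranked_layout (u : flp_var N) : R :=
  match u with
  | inl (inl i) => ranked_center i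
  | inl (inr e) => `|ranked_center (val e).1 - ranked_center (val e).2|
  | inr w => (rank (val w).1 < rank (val w).2)%N%:R
  end.

Lemma ranked_center_sep i j : (rank i < rank j)%N ->
  ranked_center i + l i <= ranked_center j - l j.
Proof.
move=> lt_ij; rewrite /ranked_center addrK.
rewrite -addrA -[l i]mul1r -mulrDl -mulrDr ler_pM2l ?ltr0n //.
rewrite [leRHS](bigD1 i) //= [leRHS]addrC lerD2r.
rewrite [leRHS](bigID (fun m => (rank m < rank i)%N)) /=.
rewrite [X in _ <= X + _](_ : _ = \sum_(m | (rank m < rank i)%N) l m).
  by rewrite lerDl sumr_ge0.
apply: eq_bigl => m; case: (ltnP (rank m) (rank i)) => [lt_mi|]; last first.
  by rewrite andbF.
rewrite (ltn_trans lt_mi lt_ij) andbT /=.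
by apply: contraTneq lt_mi => ->; rewrite ltnn.
Qed.

Lemma ranked_center_ge i : l i <= ranked_center i.
Proof. by rewrite lerDr mulr_ge0 ?ler0n // sumr_ge0. Qed.

Lemma ranked_center_le i : ranked_center i + l i <= L.
Proof.
apply: le_trans hL; rewrite /ranked_center -addrA -[l i]mul1r -mulrDl -mulrDr.
rewrite ler_pM2l ?ltr0n // [leRHS](bigID (fun m => (rank m < rank i)%N)) /=.
by rewrite lerD2l (bigD1 i) ?ltnn //= lerDl sumr_ge0.
Qed.

Lemma ranked_layoutP : layout l L ranked_layout.
Proof.
split=> [f Hf|w]; last by rewrite /=; case: ltnP; [right|left].
rewrite aevalE; move: f Hf; apply/flp_slack_ge0; split=> [e|w|e|i|w] //=.
- have := ranked_center_ge (val w).2; have := ranked_center_le (val w).1.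
  by case: ltnP => [/ranked_center_sep|_]; rewrite ?mulr0n ?mulr1n; lra.
- case: ltngtP (upair_neq e) => [_ _|_ _|/rank_inj -> /eqP //].
    by rewrite addr0.
  by rewrite add0r.
- rewrite (le_trans _ (ranked_center_ge i)) //=.
  by have := ranked_center_le i; have := l_ge0 i; lra.
- by rewrite ler0n lern1 leq_b1.
Qed.

End RankedLayout.

(** By integrality one of the two order variables of [e] equals 1, which makes the big-[L] term of
    its separation inequality vanish. *)
Lemma layout_dist_ge (R : realType) N (l : 'I_N -> R) (L : R) x (e : upair N) :
  layout l L x -> touching_dist l e <= x (dvar e).
Proof.
move=> [Hx Hz]; rewrite /touching_dist.
have /flp_slack_ge0[] : forall f, flp_slack l L f -> 0 <= aform 1 f x.
  by move=> f Hf; rewrite -aevalE Hx.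
move=> /(_ e) + Hs /(_ e) Ho _ _; move: (Hs (forward e)) (Hs (backward e)) Ho.
rewrite ler_norml /=.
by case: (Hz (forward e)) => ->; case: (Hz (backward e)) => ->; lra.
Qed.

Lemma pair_cost_le (R : realType) N (p : upair N -> R) C d1 d2 :
  (forall e, 0 <= p e) -> (forall e, d1 e <= d2 e) ->
  pair_cost p C d1 <= pair_cost p C d2.
Proof. by move=> hp le_d; apply: ler_sum => e _; exact: ler_wpM2l. Qed.

Lemma cost_le (R : realType) N (p : upair N -> R) d1 d2 :
  (forall e, 0 <= p e) -> (forall e, d1 e <= d2 e) -> cost p d1 <= cost p d2.
Proof. by move=> hp le_d; apply: ler_sum => e _; exact: ler_wpM2l. Qed.

Lemma pair_cost2 (R : realType) N (p : upair N -> R) (e : upair N) d :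
  pair_cost p [set (val e).1; (val e).2]%SET d = p e * d e.
Proof.
rewrite /pair_cost (big_pred1 e) // => -[[i j] /= lt_ij].
case: e => -[i' j'] /= lt_ij'; rewrite !inE -[RHS]val_eqE /= xpair_eqE.
apply/idP/idP => [|/andP[/eqP-> /eqP->]]; last by rewrite !eqxx orbT.
case/andP=> /orP[]/eqP ? /orP[]/eqP ?; subst.
- by rewrite ltnn in lt_ij.
- by rewrite !eqxx.
- by have := ltn_trans lt_ij lt_ij'; rewrite ltnn.
- by rewrite ltnn in lt_ij.
Qed.

(** At most one pair lies in [C], so a single layout in which its members touch attains the
    nonoverlap bound. *)
Lemma gamma_le2 (R : realType) N (l : 'I_N -> R) (p : upair N -> R) (L : R)
    (C : {set 'I_N}) :
  (forall i, 0 <= l i) -> (forall e, 0 <= p e) -> 2 * (\sum_i l i) <= L ->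
  (#|C| <= 2)%N -> is_gamma l p L C (pair_cost p C (touching_dist l)).
Proof.
move=> l_ge0 hp hL card_C; split=> [|_ [x /(@layout_dist_ge _ _ _ _) le_x <-]];
  last by apply: pair_cost_le => // e; exact: le_x.
(* The members of [C] come first, so that those of a pair are adjacent. *)
pose rank (k : 'I_N) : nat := if k \in C then nat_of_ord k else (k + N)%N.
have rank_inj : injective rank.
  move=> i j; rewrite /rank; case: ifP => _; case: ifP => _.
  - exact: val_inj.
  - by move=> eq_ij; have := ltn_ord i; rewrite eq_ij ltnNge leq_addl.
  - by move=> eq_ij; have := ltn_ord j; rewrite -eq_ij ltnNge leq_addl.
  - by move/addIn/val_inj.
exists (ranked_layout l rank); first exact: ranked_layoutP.
apply: eq_bigr => e /andP[e1C e2C]; congr (_ * _).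
have C_e : C = [set (val e).1; (val e).2]%SET.
  apply/esym/eqP; rewrite eqEcard cards2 upair_neq card_C andbT.
  by apply/fintype.subsetP=> k; rewrite !inE => /orP[]/eqP->.
have lt_e : ((val e).1 < (val e).2)%N by exact: (valP e).
rewrite /= /ranked_center /touching_dist.
(* Nothing precedes the first member [i] of the pair, and only [i] precedes the second member [j]:
   the centers are [l i] and [2 * l i + l j]. *)
rewrite big_pred0 => [|m]; last first.
  rewrite /rank e1C; case: ifP => [|_].
    rewrite C_e !inE => /orP[]/eqP->; first by rewrite ltnn.
    by rewrite ltnNge ltnW.
  by apply/negbTE; rewrite -leqNgt (leq_trans (ltnW (ltn_ord _))) ?leq_addl.
rewrite (big_pred1 (val e).1) => [|m]; last first.
  rewrite /rank e2C; case: ifP => [|mC] /=.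
    rewrite C_e !inE => /orP[]/eqP->; first by rewrite lt_e eqxx.
    by rewrite ltnn; apply/esym/negbTE; exact: upair_neqC.
  have /negbTE-> : m != (val e).1 by apply: contraFneq mC => ->.
  by apply/negbTE; rewrite -leqNgt (leq_trans (ltnW (ltn_ord _))) ?leq_addl.
rewrite distrC ger0_norm; first by ring.
by have := l_ge0 (val e).1; have := l_ge0 (val e).2; lra.
Qed.

(** The constraints of the two-element sets bound each term [p e * d e] separately, and the touching
    distances meet all of these bounds at once. *)
Lemma omega2E (R : realType) N (l : 'I_N -> R) (p : upair N -> R) (L : R) :
  (forall i, 0 <= l i) -> (forall e, 0 <= p e) -> 2 * (\sum_i l i) <= L ->
  is_omega l p L 2 (cost p (touching_dist l)).
Proof.
move=> l_ge0 hp hL; exists (fun C => pair_cost p C (touching_dist l)).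
split=> [C card_C|]; first exact: gamma_le2.
split=> [|_ [d [_ Hd] <-]].
  by exists (touching_dist l) => //; split=> // e; exact: addr_ge0.
apply: ler_sum => e _; rewrite -!pair_cost2; apply: Hd.
by rewrite cards2 upair_neq.
Qed.

(** * Lower bound for the lifted program *)

Lemma lifted_LP_dist_ge (R : realType) N (l : 'I_N -> R) (L : R) q
    (e : upair N) :
  lifted_LP l L q -> touching_dist l e <= q.1 (dvar e).
Proof.
move=> [Hq _ _].
have [] := Hq _ (forward e) (Slack_nonoverlap l L e).
rewrite /lin_mulCz /touching_dist lin_mulzE aevalE -?avar_lockedE !aformE; lra.
Qed.

(** * Reversal of ordered pairs, and the lifted point attaining the bound *)

Lemma opair_neqC N (w : opair N) : (val w).2 != (val w).1.
Proof. by rewrite eq_sym (valP w). Qed.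

Definition oswap N (w : opair N) : opair N :=
  exist _ ((val w).2, (val w).1) (opair_neqC w).

Lemma oswapK N : involutive (@oswap N).
Proof. by move=> w; apply: val_inj => /=; case: (val w). Qed.

Lemma oswap_eq N (w w' : opair N) : (oswap w == w') = (w == oswap w').
Proof. exact: inv_eq (@oswapK N) w w'. Qed.

Lemma oswap_neq N (w : opair N) : (w == oswap w) = false.
Proof.
by apply/negbTE/eqP => /(congr1 (fun v => (val v).1))/= E;
  have := valP w; rewrite /= E eqxx.
Qed.

Lemma oswap_forward N (e : upair N) : oswap (forward e) = backward e.
Proof. exact: val_inj. Qed.

Section TouchingLift.
Variables (R : realType) (N : nat) (l : 'I_N -> R) (L : R).
Hypothesis l_gt0 : forall i, 0 < l i.
Hypothesis hL : 2 * (\sum_(i < N) l i) <= L.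

Local Notation S := (\sum_(i < N) l i).

Definition incidence (w : opair N) (k : 'I_N) : R :=
  (k == (val w).2)%:R - (k == (val w).1)%:R.

Definition pair_delta (w w' : opair N) : R :=
  (w == w')%:R - (w == oswap w')%:R.

(** The amount by which the diagonal entry of the weighted Gram matrix falls short of 1. *)
Definition excess (w : opair N) : R := 1 - (l (val w).1 + l (val w).2) / S.

(* The covariance of the signs [2 z_w - 1]: a weighted Gram matrix of incidence
   vectors, with its diagonal raised to 1 in an antisymmetric way. *)
Definition sign_cov (w w' : opair N) : R :=
  (\sum_k l k * (incidence w k * incidence w' k)) / S +
  excess w * pair_delta w w'.

(** The entries mimic moments: [y(u, z_w)] is half the mean of [u] conditional on [z_w = 1], and
    [(1 + sign_cov w' w) / 4] is the mean of [z_w' * z_w] when the signs [2 z - 1] have mean 0 and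
    covariance [sign_cov]. *)
Definition touching_lift : lifted_point R N :=
  (fun u => match u with
     | inl (inl _) => L / 2
     | inl (inr e) => touching_dist l e
     | inr _ => 2^-1
     end,
   fun u w => match u with
     | inl (inl k) => (L / 2 + l k * incidence w k) / 2
     | inl (inr e) => touching_dist l e / 2
     | inr w' => (1 + sign_cov w' w) / 4
     end).

Let l_ge0 i : 0 <= l i. Proof. exact: ltW. Qed.

Lemma incidence_swap w k : incidence (oswap w) k = - incidence w k.
Proof. by rewrite /incidence opprB. Qed.

Lemma incidence_le1 w k : `|incidence w k| <= 1.
Proof.
by rewrite /incidence; case: eqP; case: eqP => _ _;
  rewrite ?mulr1n ?mulr0n ?subrr ?subr0 ?sub0r ?normrN ?normr0 ?normr1.
Qed.

Lemma shift_bound w k : `|l k * incidence w k| <= l k.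
Proof.
by rewrite normrM ger0_norm // ler_piMr // incidence_le1.
Qed.

Lemma gram_incidence w w' :
  \sum_k l k * (incidence w k * incidence w' k) =
  l (val w).2 * incidence w' (val w).2 - l (val w).1 * incidence w' (val w).1.
Proof.
have pick (i : 'I_N) :
    \sum_k l k * ((k == i)%:R * incidence w' k) = l i * incidence w' i.
  rewrite (bigD1 i) //= eqxx mul1r big1 ?addr0 // => k /negPf->.
  by rewrite mul0r mulr0.
rewrite -!pick -sumrB; apply: eq_bigr => k _.
by rewrite /incidence -mulrBr -mulrBl.
Qed.

Lemma gram_incidence_diag w :
  \sum_k l k * (incidence w k * incidence w k) = l (val w).1 + l (val w).2.
Proof.
rewrite gram_incidence /incidence !eqxx (negbTE (valP w)).
by rewrite (negbTE (opair_neqC w)) /=; ring.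
Qed.

Lemma pair_delta_sym w w' : pair_delta w w' = pair_delta w' w.
Proof. by rewrite /pair_delta -oswap_eq eq_sym [oswap w == _]eq_sym. Qed.

Lemma excess_swap w : excess (oswap w) = excess w.
Proof. by rewrite /excess /= [l _ + _]addrC. Qed.

(** [pair_delta] vanishes unless [w] and [w'] have the same underlying unordered pair, and [excess]
    depends only on that pair. *)
Lemma sign_cov_sym w w' : sign_cov w w' = sign_cov w' w.
Proof.
rewrite /sign_cov; congr (_ / _ + _).
  by apply: eq_bigr => k _; rewrite [incidence w k * _]mulrC.
rewrite pair_delta_sym /pair_delta.
case: eqP => [->//|_]; case: eqP => [->|_]; first by rewrite excess_swap.
by rewrite !subr0 !mulr0.
Qed.

Lemma sign_cov_swapl w w' : sign_cov (oswap w) w' = - sign_cov w w'.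
Proof.
rewrite /sign_cov excess_swap opprD -mulNr -sumrN -mulrN; congr (_ / _ + _ * _).
  by apply: eq_bigr => k _; rewrite incidence_swap mulNr mulrN.
by rewrite /pair_delta oswap_eq oswap_eq oswapK opprB.
Qed.

Lemma sign_cov_swapr w w' : sign_cov w (oswap w') = - sign_cov w w'.
Proof. by rewrite sign_cov_sym sign_cov_swapl sign_cov_sym. Qed.

Lemma sign_cov_diag w : sign_cov w w = 1.
Proof.
rewrite /sign_cov gram_incidence_diag /excess /pair_delta eqxx oswap_neq /=.
by ring.
Qed.

(** The pair [w] witnesses that there are components to sum over. *)
Lemma sum_gt0 (w : opair N) : 0 < S.
Proof.
apply: lt_le_trans (addr_le_sum_distinct l_ge0 (valP w)).
exact: addr_gt0.
Qed.

Lemma excess_ge0 w : 0 <= excess w.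
Proof.
rewrite subr_ge0 ler_pdivrMr ?(sum_gt0 w) // mul1r.
exact: addr_le_sum_distinct (valP w).
Qed.

Lemma sign_cov_offdiag w w' : w != w' -> w != oswap w' ->
  sign_cov w w' = (\sum_k l k * (incidence w k * incidence w' k)) / S.
Proof.
by move=> /negPf ne /negPf ne'; rewrite /sign_cov /pair_delta ne ne' subrr mulr0
  addr0.
Qed.

(** Off the diagonal, the Gram sum is at most the total of the two half-widths of [w], hence at most
    [S]. *)
Lemma sign_cov_le1 w w' : sign_cov w w' <= 1.
Proof.
have [->|ne] := eqVneq w w'; first by rewrite sign_cov_diag.
have [->|ne'] := eqVneq w (oswap w').
  by rewrite sign_cov_swapl sign_cov_diag; lra.
rewrite sign_cov_offdiag // ler_pdivrMr ?(sum_gt0 w) // mul1r.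
apply: le_trans (addr_le_sum_distinct l_ge0 (valP w)); rewrite gram_incidence.
move: (shift_bound w' (val w).1) (shift_bound w' (val w).2).
by rewrite !ler_norml => /andP[? ?] /andP[? ?]; lra.
Qed.

Lemma sign_cov_geN1 w w' : -1 <= sign_cov w w'.
Proof. by have := sign_cov_le1 (oswap w) w'; rewrite sign_cov_swapl; lra. Qed.

(** This is the separation inequality of [w] multiplied by [z_w'], doubled, with positions measured
    from [L / 2]. It is tight for [w = w']; for the reversed pair it amounts to
    [2 (l_i + l_j) <= L]. *)
Lemma touching_sep w w' :
  l (val w).1 + l (val w).2 - L * (1 - sign_cov w w') / 2 <=
  l (val w).2 * incidence w' (val w).2 - l (val w).1 * incidence w' (val w).1.
Proof.
rewrite -gram_incidence.
have le_S : l (val w).1 + l (val w).2 <= S.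
  exact: addr_le_sum_distinct (valP w).
have [->|ne] := eqVneq w w'.
  by rewrite sign_cov_diag gram_incidence_diag; lra.
have [E|ne'] := eqVneq w (oswap w').
  have -> : w' = oswap w by rewrite E oswapK.
  rewrite sign_cov_swapr sign_cov_diag.
  under eq_bigr => k _ do rewrite incidence_swap mulrN mulrN.
  by rewrite sumrN gram_incidence_diag; move: le_S (hL); set A := S; lra.
(* With [s] the covariance, the right-hand side is [s * S], while the left-hand side is at most
   [S - L (1 - s) / 2], hence at most [S - S (1 - s)]. *)
have := ler_wpM2r _ hL (x := 1 - sign_cov w w').
rewrite subr_ge0 sign_cov_le1 => /(_ isT).
have S_neq0 : S != 0 by rewrite gt_eqF ?(sum_gt0 w).
have -> : \sum_k l k * (incidence w k * incidence w' k) = sign_cov w w' * S.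
  by rewrite sign_cov_offdiag // divfK.
by lra.
Qed.

Lemma touching_lift_mulz f w : augmented_slack l L f ->
  0 <= lin_mulz f w touching_lift.
Proof.
have L_ge : forall k, 2 * l k <= L.
  move=> k; apply: le_trans hL; rewrite ler_pM2l ?ltr0n // (bigD1 k) //=.
  by rewrite lerDl sumr_ge0.
have shiftP k : - l k <= l k * incidence w k <= l k.
  by rewrite -ler_norml shift_bound.
case=> {f} [f Hf|e]; last first.
  by rewrite lin_mulzE -?avar_lockedE !aformE /= /touching_dist; lra.
rewrite lin_mulzE; move: f Hf; apply/flp_slack_ge0; split=> [e|w'|e|i|w'] /=.
- rewrite ler_norml /touching_dist.
  move: (shiftP (val e).1) (shiftP (val e).2) => /andP[? ?] /andP[? ?]; lra.
- by have := touching_sep w' w; lra.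
- by rewrite -oswap_forward sign_cov_swapl; lra.
- by have := L_ge i; have /andP[? ?] := shiftP i; lra.
- by have := sign_cov_geN1 w' w; have := sign_cov_le1 w' w; lra.
Qed.

(* The construction is invariant under exchanging [z_w] and [1 - z_w]. *)
Lemma touching_lift_mulCz f w :
  lin_mulCz f w touching_lift = lin_mulz f (oswap w) touching_lift.
Proof.
apply/eqP; rewrite /lin_mulCz subr_eq addrC !lin_mulzE -aform_split aevalE.
apply/eqP; congr aform; first by rewrite /=; lra.
apply/funext => -[[k|e]|w'] /=.
- by rewrite incidence_swap; lra.
- by lra.
- by rewrite sign_cov_swapr; lra.
Qed.

Lemma touching_lift_LP : lifted_LP l L touching_lift.
Proof.
split=> [f w Hf|w w'|w] /=.
- by rewrite touching_lift_mulCz !touching_lift_mulz.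
- by rewrite sign_cov_sym.
- by rewrite sign_cov_diag; lra.
Qed.

(** Writes the diagonal correction as a Gram matrix. Both orientations [v = w] and [v = oswap w]
    contribute the same amount, hence the weight [excess v / 2]. *)
Lemma pair_delta_gram w w' :
  \sum_v excess v / 2 * (pair_delta v w * pair_delta v w') =
  excess w * pair_delta w w'.
Proof.
have pick (F : opair N -> R) u : \sum_v (v == u)%:R * F v = F u.
  rewrite (bigD1 u) //= eqxx mul1r big1 ?addr0 // => v /negPf->.
  by rewrite mul0r.
transitivity (\sum_v (v == w)%:R * (excess v / 2 * pair_delta v w') -
              \sum_v (v == oswap w)%:R * (excess v / 2 * pair_delta v w')).
  by rewrite -sumrB; apply: eq_bigr => v _; rewrite {1}/pair_delta; ring.
rewrite !pick excess_swap /pair_delta !oswap_eq oswapK.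
by field.
Qed.

Lemma touching_lift_psd : psd (moment_matrix touching_lift).
Proof.
pose half (a : option (opair N)) : R := if a is Some _ then 2^-1 else 1.
pose ext (g : opair N -> R) (a : option (opair N)) : R :=
  if a is Some w then g w else 0.
(* Three Gram matrices: the rank-one matrix of the means, written as a sum over ['I_1], and a
   quarter of each summand of [sign_cov], extended by 0 to the index [None]. *)
apply: (@psd_ext _ _ (fun a b =>
    \sum_(i : 'I_1) 1 * (half a * half b) +
   (\sum_k l k / (4 * S) * (ext (incidence^~ k) a * ext (incidence^~ k) b) +
    \sum_v excess v / 8 * (ext (pair_delta v) a * ext (pair_delta v) b)))).
  move=> [w|] [w'|]; rewrite big_ord1 mul1r /=.
  - rewrite /sign_cov -pair_delta_gram [RHS]mulrDl [in RHS]mulrDl.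
    rewrite !mulr_suml; congr (_ + (_ + _)); first by field.
      by apply: eq_bigr => k _; rewrite [4 * S]mulrC invfM; ring.
    by apply: eq_bigr => v _; field.
  - do 2!(rewrite big1; last by move=> ? _; rewrite ?(mul0r, mulr0)).
    by rewrite !addr0 mulr1.
  - do 2!(rewrite big1; last by move=> ? _; rewrite ?(mul0r, mulr0)).
    by rewrite !addr0 mul1r.
  - do 2!(rewrite big1; last by move=> ? _; rewrite ?(mul0r, mulr0)).
    by rewrite !addr0 mul1r.
apply: psdD; first by apply: psd_gram => i; exact: ler01.
apply: psdD; apply: psd_gram => i.
  by rewrite divr_ge0 // mulr_ge0 ?sumr_ge0 ?ler0n.
by rewrite divr_ge0 ?excess_ge0 ?ler0n.
Qed.

End TouchingLift.

Theorem proposition4p2 (R : realType) (N : nat) (l : 'I_N -> R)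
    (p : upair N -> R) (L : R)
    (hl : forall i : 'I_N, 0 < l i)
    (hp : forall e : upair N, 0 <= p e)
    (hL : 2 * (\sum_(i < N) l i) <= L) :
  exists omega2 : R,
    [/\ is_omega l p L 2 omega2,
        is_optimal_cost p (lifted_LP l L) omega2
      & is_optimal_cost p (lifted_SDP l L) omega2].
Proof.
exists (cost p (touching_dist l)).
have LP_lbound q : lifted_LP l L q ->
    cost p (touching_dist l) <= cost p (q.1 \o @dvar N).
  by move=> Hq; apply: cost_le => // e; exact: lifted_LP_dist_ge Hq.
have lift_LP := touching_lift_LP hl hL.
split; first by apply: omega2E => // i; exact: ltW.
- split=> [|_ [q Hq <-]]; last exact: LP_lbound.
  by exists (touching_lift l L).
- split=> [|_ [q [Hq _] <-]]; last exact: LP_lbound.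
  by exists (touching_lift l L) => //; split=> //; exact: touching_lift_psd.
Qed.
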